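(* For every infinite cardinal $\kappa$ there is a dense linear order $(X,<)$ of cardinality $\kappa$ such that for every subset $S\subseteq X$, Player II has a winning strategy in the game $BG(X,S)$.
   Context: Let $(X,<)$ be a dense linear order and $S\subseteq X$. The game $BG(X,S)$ is the following two-player game of perfect information of length $\omega$. Player I starts by picking $a_0\in X$, where $a_0$ is not the greatest element of $X$ (if $X$ has one). Then Player II picks $b_0\in X$ with $a_0<b_0$. In turn $n\geq 1$, Player I picks $a_n\in X$ with $a_{n-1}<a_n<b_{n-1}$, and then Player II picks $b_n\in X$ with $a_n<b_n<b_{n-1}$. Density ensures that there is always a legal move after the first one. After $\omega$-many turns, Player I wins if there is $x\in S$ such that $a_n<x<b_n$ for all $n<\omega$; otherwise Player II wins. *)

(* Defs.v *)
From mathcomp Require Import all_boot all_order.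
From mathcomp Require Import boolp classical_sets functions cardinality.

Set Implicit Arguments.
Unset Strict Implicit.
Unset Printing Implicit Defensive.

Import Order.TTheory.

Local Open Scope classical_set_scope.
Local Open Scope order_scope.

Definition dense_order d (X : orderType d) : Prop :=
  forall x y : X, x < y -> exists z : X, x < z < y.

Section BGame.
Context (d : Order.disp_t) (X : orderType d).

(* A run is a pair of sequences [a] (moves of Player I) and [b] (moves of
   Player II); in turn [n] Player I picks [a n] and then Player II picks [b n].
   [ubound [set: X] x] says that [x] is the greatest element of [X]. *)
Definition BG_legalI (a b : nat -> X) (n : nat) : Prop :=
  match n with
  | 0 => ~ ubound [set: X] (a 0)
  | m.+1 => a m < a m.+1 < b m
  end.

Definition BG_legalII (a b : nat -> X) (n : nat) : Prop :=
  match n with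
  | 0 => a 0 < b 0
  | m.+1 => a m.+1 < b m.+1 < b m
  end.

Definition BG_wonI (S : set X) (a b : nat -> X) : Prop :=
  exists2 x : X, S x & forall n : nat, a n < x < b n.

(* A strategy for Player II maps the sequence [:: a_0; ...; a_n] of the moves
   made so far by Player I to the reply b_n. *)
Definition BG_strategyII : Type := seq X -> X.

Definition BG_follows (sigma : BG_strategyII) (a b : nat -> X) : Prop :=
  forall n : nat, b n = sigma (mkseq a n.+1).

(* The strategy has to supply a legal reply in turn [n] as soon as Player I has
   moved legally in turns [0, ..., n], whatever happens in later turns. *)
Definition BG_winningII (S : set X) (sigma : BG_strategyII) : Prop :=
  forall a b : nat -> X, BG_follows sigma a b ->
    (forall n : nat, (forall m : nat, (m <= n)%N -> BG_legalI a b m) ->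
       BG_legalII a b n) /\
    ((forall n : nat, BG_legalI a b n) -> ~ BG_wonI S a b).

End BGame.

(* Main.v *)
Require Import Defs.
From HB Require Import structures.
From mathcomp Require Import all_boot all_order all_algebra.
From mathcomp Require Import boolp classical_sets functions cardinality.
From mathcomp Require wochoice.

(** Player II wins whenever the order is covered by countably many sets [A n]
    none of which accumulates at a point from the right: in turn [n], facing
    [a_n], Player II chooses [b_n] so close to [a_n] that the interval
    [(a_n, b_n)] misses [A n]. A point lying in all the intervals would belong
    to some [A n], so nothing is left for Player I, whatever [S] is
    ([winningII_of_no_right_limit_cover]).

    Such a cover exists for every lexicographic product of a linear order [L]
    with the rationals. To the right of [(l, q)] there is a copy of the
    rational interval [(q, q + 1)] inside the fibre of [l], and each level
    [{p | p.2 = r}] has only one point in that fibre; the countably many levels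
    cover the product ([lexrat_winningII]).

    It remains to give [L * rat] the prescribed cardinality [K], for a suitable
    set [L] linearly ordered by the well-ordering principle. By Zorn's lemma
    there is a maximal family [L] of pairwise disjoint injective sequences in
    [K]; maximality leaves only finitely many points of [K] outside their
    ranges. Hence [L * nat], and so [L * rat], embeds in [K], while a countable
    set of indices per sequence leaves room to map [L * rat] onto the ranges and
    the finite remainder; Cantor-Bernstein concludes
    ([infinite_card_prod_rat]). *)

Local Open Scope classical_set_scope.
Local Open Scope card_scope.

Import Order.TTheory GRing.Theory Num.Theory.

(** * A sufficient condition for Player II to win *)

Section NoRightLimit.
Context {d : Order.disp_t} {X : orderType d}.
Local Open Scope order_scope.

Definition no_right_limit (A : set X) : Prop :=
  forall a : X, ~ ubound [set: X] a ->
    exists2 y : X, a < y & forall z, A z -> ~~ (a < z < y).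

(** In the first turn there is no upper bound to respect, which [c = None]
    encodes. *)
Definition reply_spec (A : set X) (a : X) (c : option X) (y : X) : Prop :=
  [/\ a < y, (if c is Some c' then y < c' else true) &
      forall z, A z -> ~~ (a < z < y)].

(** Density serves to go strictly below both the bound [c] and the point
    isolating [a] from [A]. *)
Lemma exists_reply (A : set X) (a : X) (c : option X) :
    dense_order X -> no_right_limit A ->
    (if c is Some c' then is_true (a < c') else ~ ubound [set: X] a) ->
  exists y, reply_spec A a c y.
Proof.
move=> dX isoA; case: c => [c ac|ua]; last first.
  by have [y ay yA] := isoA a ua; exists y; split.
have ua : ~ ubound [set: X] a.
  by move=> /(_ c I); rewrite leNgt ac.
have [y ay yA] := isoA a ua.
have [w /andP[aw wm]] : exists w, a < w < Order.min y c.
  by apply: dX; rewrite lt_min ay.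
move: wm; rewrite lt_min => /andP[wy wc].
exists w; split=> // z Az; apply: contra (yA z Az) => /andP[-> zw] /=.
exact: lt_trans wy.
Qed.

Lemma winningII_of_no_right_limit_cover
    (x0 : X) (A : nat -> set X) (S : set X) :
    dense_order X -> (forall n, no_right_limit (A n)) ->
    (forall x, exists n, A n x) ->
  exists sigma : BG_strategyII X, BG_winningII S sigma.
Proof.
move=> dX isoA coverA.
pose reply n a c := xget x0 (reply_spec (A n) a c).
have replyP n a c :
    (if c is Some c' then is_true (a < c') else ~ ubound [set: X] a) ->
    reply_spec (A n) a c (reply n a c).
  by move=> /(exists_reply _ _ _ dX (isoA n)) ex; exact: xgetPex.
(* The latest move is wanted first, so the recursion runs over the reversed
   history; the number of earlier moves is the index of the set to avoid. *)
pose fix rho (s : seq X) : X :=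
  if s is a :: s' then
    reply (size s') a (if s' is [::] then None else Some (rho s'))
  else x0.
exists (fun s => rho (rev s)) => a b sigmab.
have b0 : b 0 = reply 0 (a 0) None by rewrite sigmab.
have bS n : b n.+1 = reply n.+1 (a n.+1) (Some (b n)).
  rewrite !sigmab mkseqS rev_rcons /= size_rev size_mkseq.
  by rewrite mkseqS rev_rcons.
have spec n : BG_legalI a b n ->
    reply_spec (A n) (a n) (if n is m.+1 then Some (b m) else None) (b n).
  case: n => [|n] /= => [ua|/andP[_ ab]]; first by rewrite b0; exact: replyP.
  by rewrite bS; exact: replyP.
split=> [n legI|legI [x _ axb]].
  have := spec n (legI n (leqnn n)).
  by case: n {legI} => [|n] [] //= -> ->.
have [n Anx] := coverA x.
by have [_ _ /(_ x Anx)] := spec n (legI n); rewrite axb.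
Qed.

End NoRightLimit.

(** * Lexicographic products with the rationals *)

Section LexRat.
Context (d : Order.disp_t) (L : orderType d).
Local Open Scope order_scope.

Definition lexrat := (L *lexi[d] rat)%type.

Lemma lexrat_ltE (p q : lexrat) :
  (p < q) = (p.1 < q.1) || ((p.1 == q.1) && (p.2 < q.2)).
Proof. by rewrite ltEprodlexi; case: (ltgtP p.1 q.1). Qed.

Lemma lexrat_dense : dense_order lexrat.
Proof.
move=> [l q] [m r]; rewrite lexrat_ltE /= => /orP[lm|/andP[/eqP-> qr]].
  by exists (l, (q + 1)%R); rewrite !lexrat_ltE /= lm eqxx ltrDl ltr01 orbT.
exists (m, ((q + r) / 2%:R)%R).
by rewrite !lexrat_ltE /= !eqxx !midf_lt ?orbT.
Qed.

(** Staying in the fibre of [l], a level has at most one point to the right of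
    [(l, q)], namely [(l, r)] when [q < r], and then one can stop just there. *)
Lemma lexrat_level_no_right_limit (r : rat) :
  no_right_limit [set p : lexrat | p.2 = r].
Proof.
move=> [l q] _.
exists (l, if q < r then r else (q + 1)%R).
  rewrite lexrat_ltE /= eqxx.
  by case: ifP => [->|_]; rewrite ?ltrDl ?ltr01 orbT.
move=> [m _] /= ->; apply/negP; rewrite !lexrat_ltE /= => /andP[].
move=> /orP[lm|/andP[/eqP <- qr]].
  by rewrite ltNge (ltW lm) /= eq_sym (lt_eqF lm).
by rewrite qr !ltxx andbF.
Qed.

Lemma lexrat_winningII (l0 : L) (S : set lexrat) :
  exists sigma : BG_strategyII lexrat, BG_winningII S sigma.
Proof.
pose A n := [set p : lexrat | p.2 = odflt 0%R (unpickle n)].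
apply: (@winningII_of_no_right_limit_cover _ lexrat (l0, 0%R) A).
- exact: lexrat_dense.
- by move=> n; exact: lexrat_level_no_right_limit.
- by move=> p; exists (pickle p.2); rewrite /A /= pickleK.
Qed.

End LexRat.

(** * A linear order on an arbitrary type *)

(** A fresh name for [T], to carry the order structure that the well-ordering
    principle provides. *)
Definition well_ordered (T : Type) : Type := {classic T}.

HB.instance Definition _ (T : Type) := Choice.on (well_ordered T).

Section WellOrdered.
Context (T : Type).
Local Notation W := (well_ordered T).

Definition wo_le : rel W := sval (wochoice.well_ordering_principle W).

Let woW : wochoice.wo_chain wo_le predT.
Proof.
apply: wochoice.withinW.
exact: (svalP (wochoice.well_ordering_principle W)).
Qed.

Let wo_total : total wo_le.
Proof. by move=> x y; exact: (wochoice.wo_chainW woW). Qed.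

Let wo_anti : antisymmetric wo_le.
Proof. by move=> x y; exact: (wochoice.wo_chain_antisymmetric woW). Qed.

(** Transitivity follows by looking at the minimum of the three points. *)
Let wo_trans : transitive wo_le.
Proof.
move=> y x z xy yz.
have [|w [[/or3P[]/eqP-> wmin] _]] :=
  woW (fun w => [|| w == x, w == y | w == z]) (fun _ _ => isT).
- by exists x; apply/or3P; constructor 1.
- by apply: wmin; apply/or3P; constructor 3.
- have yx : wo_le y x by apply: wmin; apply/or3P; constructor 1.
  by rewrite (wo_anti x y) // xy.
- have zy : wo_le z y by apply: wmin; apply/or3P; constructor 2.
  by rewrite -(wo_anti y z) // yz.
Qed.

HB.instance Definition _ := @Order.isOrder.Build (Order.Disp tt tt) W
  wo_le _ _ _ (fun _ _ => erefl) (fun _ _ => erefl) (fun _ _ => erefl)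
  wo_anti wo_trans wo_total.

End WellOrdered.

(** * The cardinality of the product *)

Lemma injective_card_le (T U : Type) (f : T -> U) :
  injective f -> [set: T] #<= [set: U].
Proof.
move=> finj; apply/card_le_trans; last exact: card_leT (range f).
have : range f #= [set: T] by apply: inj_card_eq => x y _ _; exact: finj.
by rewrite card_eq_le => /andP[].
Qed.

Lemma surjective_card_ge (T U : Type) (f : T -> U) :
  (forall u, exists t, f t = u) -> [set: U] #<= [set: T].
Proof.
move=> /choice[g fg]; apply: (@injective_card_le _ _ g).
exact: can_inj fg.
Qed.

Definition disjoint_sequences (K : Type) (G : set (nat -> K)) : Prop :=
  (forall g, G g -> injective g) /\
  (forall g h m n, G g -> G h -> g m = h n -> g = h).

(** If infinitely many points were left over, a sequence through them would
    extend a maximal family. *)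
Lemma exists_disjoint_sequences_cofinite (K : Type) :
  exists2 G : set (nat -> K), disjoint_sequences K G &
    finite_set [set x | forall g n, G g -> g n <> x].
Proof.
have [F FG tF|G [Gdis Gmax]] := @Zorn_bigcup _ (disjoint_sequences K).
  split=> [g [G /FG[+ _] Gg]|g h m n [G1 F1 G1g] [G2 F2 G2h]].
    exact.
  have [G12|G21] := tF _ _ F1 F2.
    by have [_] := FG _ F2; apply=> //; exact: G12.
  by have [_] := FG _ F1; apply=> //; exact: G21.
exists G => //; apply: contrapT => /infiniteP/card_leP[f].
pose e n : K := val (f (SigSub (mem_set (I : [set: nat] n)))).
have e_inj : injective e.
  move=> m n /val_inj /(@inj _ _ _ f _ _ (mem_set I) (mem_set I)).
  by move=> /(congr1 val).
have e_new n g k : G g -> g k <> e n.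
  by have /set_mem := valP (f (SigSub (mem_set (I : [set: nat] n)))); exact.
apply: (Gmax (G `|` [set e])).
  split=> [g|]; first by left.
  by move=> /(_ e (or_intror erefl)) Ge; exact: (e_new 0%N e 0%N).
split=> [g [|->//]|g h m n [Gg|->] [Gh|->] //].
- exact: Gdis.1.
- exact: Gdis.2.
- by move=> /e_new; case.
- by move=> /esym/e_new; case.
Qed.

(** This replaces the cardinal identity [kappa * aleph_0 = kappa]: only some
    factor [L] is needed, and it is the family of sequences itself. *)
Lemma infinite_card_prod_rat (K : Type) : infinite_set [set: K] ->
  exists2 L : Type, $|L| & [set: L * rat] #= [set: K].
Proof.
move=> Kinf; have [G [Ginj Gdis] Rfin] := exists_disjoint_sequences_cofinite K.
set R := [set x | _] in Rfin.
have [g0 Gg0] : exists g, G g.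
  apply: contrapT => noG; apply: Kinf.
  by apply: sub_finite_set Rfin => x _ g n Gg; case: noG; exists g.
have /pcard_injP[f finj] := finite_set_countable Rfin.
exists {g | G g}; first by squash (exist _ g0 Gg0).
rewrite card_eq_le; apply/andP; split.
  apply: (@injective_card_le _ _ (fun p => sval p.1 (pickle p.2))).
  move=> [[g Gg] q] [[h Gh] r] /= gqhr.
  have gh := Gdis _ _ _ _ Gg Gh gqhr; move: Gg gqhr; rewrite gh => Gg.
  move=> /(Ginj _ Gg)/(pcan_inj pickleK)->.
  by rewrite (Prop_irrelevance Gg Gh).
pose e n := xget (g0 0%N : {classic K}) [set x | R x /\ f x = n].
have eK x : R x -> e (f x) = x.
  move=> Rx; have [Re fe] : R (e (f x)) /\ f (e (f x)) = f x.
    by apply: (@xgetPex {classic K} _ [set y | R y /\ f y = f x]); exists x.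
  by apply: finj fe; rewrite inE.
(* A surjection from [rat] onto two copies of [nat]: one to run through the
   sequence at hand, the other to run through the remainder. *)
pose dec (q : rat) : nat + nat := odflt (inl 0%N) (unpickle `|numq q|%N).
have decK c : dec (pickle c)%:Q%R = c by rewrite /dec numq_int pickleK.
apply: (@surjective_card_ge _ _ (fun p : {g | G g} * rat =>
  match dec p.2 with inl n => sval p.1 n | inr n => e n end)) => x.
have [[g [n Gg gnx]]|notin] := pselect (exists g, exists2 n, G g & g n = x).
  by exists (exist _ g Gg, (pickle (inl n : nat + nat))%:Q%R); rewrite decK.
exists (exist _ g0 Gg0, (pickle (inr (f x) : nat + nat))%:Q%R); rewrite decK.
by apply: eK => g n Gg gnx; apply: notin; exists g, n.
Qed.

Theorem corollary3p4 (K : Type) (hK : infinite_set [set: K]) :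
  exists (d : Order.disp_t) (X : orderType d),
    [/\ dense_order X,
        [set: X] #= [set: K] &
        forall S : set X, exists sigma : BG_strategyII X, BG_winningII S sigma].
Proof.
have [L [l0] LK] := infinite_card_prod_rat K hK.
exists _, (lexrat _ (well_ordered L)); split=> //.
  exact: lexrat_dense.
by move=> S; exact: lexrat_winningII.
Qed.
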